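(* Let $R$ be a commutative ring with unit $1$ which is the direct sum of its subrings $R_i$ (with unit $e_i$), $R=\bigoplus_{i=1}^t R_i$. Let $(N,+)$ be an abelian group which is also an $R$-module. Then $$N=\bigoplus_{i=1}^t N_i,\qquad ( * )$$ where $N_i=e_iN$ is an $R$-module which is annihilated by $R_j$ for all $j\neq i$. If, in addition, $(N,+)$ has also a structure $(N,+,\circ)$ of $R$-brace, then for each $i$, $N_i$ is a left $R$-ideal of $N$. Moreover, in this case, all the $N_i$'s are normal in $(N,\circ)$ (or, equivalently, all the $N_i$'s are ideals of $N$) if and only if the decomposition $( * )$ is a decomposition of $R$-braces.
   Context: A (left) brace is a set $N$ with two group operations $+$ and $\circ$, with $(N,+)$ abelian, such that $x\circ(y+z)=(x\circ y)-x+(x\circ z)$ for all $x,y,z\in N$. Its gamma function is $x\mapsto\gamma_x$, where $\gamma_x(y)=-x+x\circ y$; each $\gamma_x$ is an automorphism of $(N,+)$. Given a ring $R$, an $R$-brace is a brace $(N,+,\circ)$ such that $(N,+)$ is an $R$-module and every $\gamma_x$ ($x\in N$) is an automorphism of $R$-modules. Modules are unital. A left ideal of a brace $N$ is a subset $A$ with $\gamma_x(A)\subseteq A$ for all $x\in N$ which is a subgroup of $(N,+)$ (equivalently of $(N,\circ)$). An ideal is a left ideal that is a normal subgroup of both $(N,+)$ and $(N,\circ)$. A left $R$-ideal of an $R$-brace is a left ideal which is also an $R$-submodule. The direct sum $R=\bigoplus R_i$ is a direct sum of rings, so $e_1,\dots,e_t$ are orthogonal idempotents with $e_1+\dots+e_t=1$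 and $R_i=Re_i$. The direct product of braces has componentwise operations $+$ and $\circ$ (and componentwise $R$-action for $R$-braces). An isomorphism of $R$-braces is a bijection that is an isomorphism for $+$ and for $\circ$ and is $R$-linear. The decomposition $( * )$ is a decomposition of $R$-braces if the map $N\to N_1\times\dots\times N_t$, $x\mapsto(e_1x,\dots,e_tx)$, is an isomorphism of $R$-braces. *)

(* Defs.v *)
From HB Require Import structures.
From mathcomp Require Import all_boot all_order all_algebra.
From mathcomp Require Import boolp classical_sets functions.
Set Implicit Arguments.
Unset Strict Implicit.
Unset Printing Implicit Defensive.
Import GRing.Theory.
Local Open Scope classical_set_scope.
Local Open Scope ring_scope.

(* [x + y] is the additive group operation and [(x * y)%g] is the circle
   operation; [1%g], [(x^-1)%g] and [(x ^ y)%g] also refer to the latter. *)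
HB.mixin Record Zmodule_Group_isBrace N of GRing.Zmodule N & Group N := {
  braceD : forall x y z : N, (x * (y + z)%R)%g = (x * y)%g - x + (x * z)%g
}.

#[short(type="braceType")]
HB.structure Definition Brace :=
  {N of Zmodule_Group_isBrace N & GRing.Zmodule N & Group N}.

Definition gamma (N : braceType) (x y : N) : N := - x + (x * y)%g.

HB.mixin Record Brace_isRBrace (R : pzRingType) N
    of Brace N & GRing.Lmodule R N := {
  gamma_linear : forall x : N, linear (gamma x);
  gamma_bij : forall x : N, bijective (gamma x)
}.

#[short(type="rBraceType")]
HB.structure Definition RBrace (R : pzRingType) :=
  {N of Brace_isRBrace R N & Brace N & GRing.Lmodule R N}.

(* Finite direct powers of an R-brace, with all operations componentwise: the
   additive group, module and circle group structures are those of the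
   library on finite functions. *)
Section Power.

Lemma ffun_braceD (I : finType) (N : braceType) (x y z : {ffun I -> N}) :
  (x * (y + z)%R)%g = (x * y)%g - x + (x * z)%g.
Proof. by apply/ffunP => i; rewrite !ffunE braceD. Qed.

HB.instance Definition _ (I : finType) (N : braceType) :=
  Zmodule_Group_isBrace.Build {ffun I -> N} (@ffun_braceD I N).

Variables (R : pzRingType) (I : finType) (N : rBraceType R).

Lemma ffun_gammaE (x y : {ffun I -> N}) i : gamma x y i = gamma (x i) (y i).
Proof. by rewrite /gamma !ffunE. Qed.

Lemma ffun_gamma_linear (x : {ffun I -> N}) : linear (gamma x).
Proof.
by move=> a y z; apply/ffunP => i; rewrite !(ffun_gammaE, ffunE) gamma_linear.
Qed.

Lemma ffun_gamma_bij (x : {ffun I -> N}) : bijective (gamma x).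
Proof.
exists (fun y => (x^-1 * (x + y)%R)%g) => y; rewrite /gamma.
  by rewrite addrA subrr add0r mulKg.
by rewrite mulVKg addrA addNr add0r.
Qed.

HB.instance Definition _ := Brace_isRBrace.Build R {ffun I -> N}
  ffun_gamma_linear ffun_gamma_bij.

End Power.

Definition is_left_ideal (N : braceType) (A : set N) : Prop :=
  zmod_closed [in A] /\ forall x : N, gamma x @` A `<=` A.

Definition is_left_R_ideal (R : pzRingType) (N : rBraceType R)
    (A : set N) : Prop :=
  is_left_ideal A /\ submod_closed [in A].

Definition is_add_normal (N : zmodType) (A : set N) : Prop :=
  zmod_closed [in A] /\ forall a x : N, A a -> A (- x + a + x).

Definition is_circ_normal (N : groupType) (A : set N) : Prop :=
  group_closed [in A] /\ forall a x : N, A a -> A (a ^ x)%g.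

Definition is_ideal (N : braceType) (A : set N) : Prop :=
  [/\ is_left_ideal A, is_add_normal A & is_circ_normal A].

Definition is_direct_sum (V : zmodType) (t : nat) (A : 'I_t -> set V) : Prop :=
  (forall i, zmod_closed [in A i]) /\
  forall x : V, exists! y : {ffun 'I_t -> V},
    (forall i, A i (y i)) /\ x = \sum_(i < t) y i.

(* R is the internal direct sum of the subrings R_ i with units e i; the
   subrings are not required to contain the unit of R. *)
Record is_ring_direct_sum (R : comPzRingType) (t : nat)
    (R_ : 'I_t -> set R) (e : 'I_t -> R) : Prop := IsRingDirectSum {
  rds_sum : is_direct_sum R_;
  rds_mul : forall i x y, R_ i x -> R_ i y -> R_ i (x * y);
  rds_one : forall i, R_ i (e i);
  rds_mul1 : forall i x, R_ i x -> e i * x = x;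
  rds_mul0 : forall i j x y, i != j -> R_ i x -> R_ j y -> x * y = 0
}.

Definition component (R : pzRingType) (N : lmodType R) (e : R) : set N :=
  [set e *: x | x in setT].
Arguments component {R} N e.

(* f is an isomorphism of R-braces from N onto the subset B of M endowed with
   the operations of M. *)
Record is_rBrace_iso (R : pzRingType) (N M : rBraceType R) (B : set M)
    (f : N -> M) : Prop := IsRBraceIso {
  iso_bij : set_bij setT B f;
  iso_add : {morph f : x y / x + y};
  iso_circ : {morph f : x y / (x * y)%g};
  iso_scale : scalable f
}.

(* When the A i are left R-ideals of an R-brace N, hence R-braces under the
   operations of N, this subset of the direct power of N is their direct
   product. *)
Definition direct_product (N : Type) (t : nat) (A : 'I_t -> set N) :
    set {ffun 'I_t -> N} :=
  [set y | forall i, A i (y i)].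

Definition is_rBrace_decomposition (R : comPzRingType) (N : rBraceType R)
    (t : nat) (e : 'I_t -> R) : Prop :=
  is_rBrace_iso (direct_product (fun i => component N (e i)))
    (fun x : N => [ffun i => e i *: x]).

(* Main.v *)
Require Import Defs.
From mathcomp Require Import all_boot all_order all_algebra.
From mathcomp Require Import boolp classical_sets functions.
Import GRing.Theory.
Local Open Scope ring_scope.

(** The units e_i of the summands R_i are orthogonal idempotents with sum 1, so
    e_i N is the set of fixed points of the projection x |-> e_i x, every x is
    the sum of its projections, and the projections are independent
    ([component_direct_sum]).  As the maps gamma_x are R-linear, they commute
    with all the projections, and each e_i N is a left R-ideal.

    Suppose that all the e_i N are normal for the circle operation.  For a in
    e_i N and b in e_j N with i and j distinct, the circle commutator of a and b
    lies in both components, hence is trivial; comparing a + gamma_a(b) with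
    b + gamma_b(a) and using independence once more gives gamma_a(b) = b
    ([normal_left_ideals_gamma_fix]).  Hence every w in the sum of the e_j N
    with j <> i acts trivially on e_i N ([gamma_complement_fix]).  Writing x as
    such a w plus e_i x, which is also w circle e_i x, shows that gamma_x and
    gamma_(e_i x) agree on e_i N; since x circle y = x + gamma_x(y), this says
    that the projection x |-> e_i x is multiplicative ([component_circM]).

    Conversely, if the projections are multiplicative, then for a in e_i N the
    j-th projection of a conjugate of a is, when j <> i, a conjugate of
    e_j a = 0.  In a brace 0 is also the circle identity, so this projection
    vanishes and the conjugate stays in e_i N. *)

(** * The gamma function and left ideals of a brace *)

Section BraceTheory.
Variable N : braceType.
Implicit Types (x y z : N) (A B : set N).

Lemma brace_one : (1%g : N) = 0.
Proof.
have := @braceD N 1%g 0 0; rewrite !mul1g add0r addr0 sub0r => /esym/eqP.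
by rewrite oppr_eq0 => /eqP.
Qed.

Lemma circ_gammaE x y : (x * y)%g = x + gamma x y.
Proof. by rewrite /gamma addrA subrr add0r. Qed.

Lemma gammaD x y z : gamma x (y + z) = gamma x y + gamma x z.
Proof. by rewrite /gamma braceD !addrA. Qed.

Lemma gamma0 x : gamma x 0 = 0.
Proof. by rewrite /gamma -brace_one mulg1 brace_one addNr. Qed.

Lemma gamma1 y : gamma 1%g y = y.
Proof. by rewrite /gamma mul1g brace_one oppr0 add0r. Qed.

Lemma gammaM x y z : gamma (x * y)%g z = gamma x (gamma y z).
Proof.
apply: (@addrI _ (x * y)%g); rewrite -circ_gammaE -mulgA (circ_gammaE y z).
by rewrite (circ_gammaE x (y + _)) (gammaD x y (gamma y z)) [LHS]addrA
  -circ_gammaE.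
Qed.

Lemma invg_gammaE x : (x^-1)%g = - gamma (x^-1)%g x.
Proof. by rewrite /gamma mulVg brace_one addr0 opprK. Qed.

Lemma left_ideal_gamma {A x a} : is_left_ideal A -> A a -> A (gamma x a).
Proof. by case=> _ AG Aa; apply: (AG x); exists a. Qed.

Lemma left_idealB {A a b} : is_left_ideal A -> A a -> A b -> A (a - b).
Proof. by case=> -[_ AB] _ /mem_set Aa /mem_set Ab; apply/set_mem/AB. Qed.

Lemma left_ideal0 {A} : is_left_ideal A -> A 0.
Proof. by case=> -[/set_mem]. Qed.

Lemma left_idealN {A a} : is_left_ideal A -> A a -> A (- a).
Proof.
by move=> AI Aa; rewrite -sub0r; apply: left_idealB => //; apply: left_ideal0.
Qed.

Lemma left_idealD {A a b} : is_left_ideal A -> A a -> A b -> A (a + b).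
Proof.
by move=> AI Aa Ab; rewrite -[b]opprK; apply: left_idealB => //;
  apply: left_idealN.
Qed.

Lemma left_idealM {A a b} : is_left_ideal A -> A a -> A b -> A (a * b)%g.
Proof.
move=> AI Aa Ab; rewrite circ_gammaE; apply: left_idealD => //.
exact: left_ideal_gamma.
Qed.

Lemma left_idealV {A a} : is_left_ideal A -> A a -> A (a^-1)%g.
Proof.
by move=> AI Aa; rewrite invg_gammaE; apply: left_idealN => //;
  apply: left_ideal_gamma.
Qed.

Lemma left_ideal_group_closed {A} : is_left_ideal A -> group_closed [in A].
Proof.
move=> AI; split=> [|a b].
  by rewrite in_setE brace_one; apply: left_ideal0.
by rewrite !in_setE => Aa Ab; apply: left_idealM => //; apply: left_idealV.
Qed.

Lemma add_normal_zmod_closed {A} : zmod_closed [in A] -> is_add_normal A.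
Proof. by move=> AI; split=> // a x; rewrite addrAC addNr add0r. Qed.

(** The circle commutator of a and b lies in both ideals, so a and b commute;
    then gamma_a(b) - b = gamma_b(a) - a lies in both ideals as well. *)
Lemma normal_left_ideals_gamma_fix {A B} :
    is_left_ideal A -> is_left_ideal B ->
    is_circ_normal A -> is_circ_normal B ->
    (forall x, A x -> B x -> x = 0) ->
  forall a b, A a -> B b -> gamma a b = b.
Proof.
move=> AI BI [_ An] [_ Bn] AB0 a b Aa Bb.
have cab : [~ a, b]%g = 1%g.
  rewrite brace_one; apply: AB0.
    by rewrite commgEl; apply: left_idealM => //;
      [apply: left_idealV | apply: An].
  by rewrite commgEr; apply: left_idealM => //; apply: Bn; apply: left_idealV.
have /eqP := cab; rewrite -conjg_fix => /eqP abE.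
have abC : (a * b = b * a)%g by rewrite conjgC abE.
have eqD : gamma a b - b = gamma b a - a.
  apply: (@addrI _ (a + b)); rewrite [LHS]addrACA subrr addr0 -circ_gammaE abC.
  by rewrite [a + b]addrC [RHS]addrACA subrr addr0 -circ_gammaE.
apply/eqP; rewrite -subr_eq0; apply/eqP; apply: AB0.
  by rewrite eqD; apply: left_idealB => //; apply: left_ideal_gamma.
by apply: left_idealB => //; apply: left_ideal_gamma.
Qed.

End BraceTheory.

Lemma gammaZ (R : pzRingType) (N : rBraceType R) (x y : N) (r : R) :
  gamma x (r *: y) = r *: gamma x y.
Proof. by have := gamma_linear x r y 0; rewrite !addr0 gamma0 addr0. Qed.

(** * Decompositions along orthogonal idempotents *)

Section Idempotents.
Variables (R : comPzRingType) (t : nat) (e : 'I_t -> R).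
Hypothesis idem : forall i, e i * e i = e i.
Hypothesis orth : forall i j, i != j -> e i * e j = 0.
Hypothesis sum1 : \sum_(i < t) e i = 1.

Section Modules.
Variable N : lmodType R.
Implicit Types (x y : N).

Lemma componentP i x : component N (e i) x <-> e i *: x = x.
Proof.
split=> [[z _ <-]|<-]; last by exists x.
by rewrite scalerA idem.
Qed.

Lemma component_scale i x : component N (e i) (e i *: x).
Proof. by exists x. Qed.

Lemma component_scale0 i j x : i != j -> component N (e j) x -> e i *: x = 0.
Proof. by move=> ij [z _ <-]; rewrite scalerA orth // scale0r. Qed.

Lemma sum_scale x : x = \sum_(i < t) e i *: x.
Proof. by rewrite -scaler_suml sum1 scale1r. Qed.

Lemma componentI i j x :
  i != j -> component N (e i) x -> component N (e j) x -> x = 0.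
Proof.
by move=> ij /componentP xi /(component_scale0 _ _ _ ij); rewrite xi.
Qed.

Lemma scale_sum_component (y : 'I_t -> N) :
  (forall i, component N (e i) (y i)) ->
  forall i, e i *: (\sum_(j < t) y j) = y i.
Proof.
move=> yP i; rewrite scaler_sumr (bigD1 i) //= big1 ?addr0 => [|j ji].
  exact/componentP.
by apply: (component_scale0 _ j) => //; rewrite eq_sym.
Qed.

Lemma component_submod i : submod_closed [in component N (e i)].
Proof.
split=> [|a x y]; rewrite !in_setE; first by exists 0; rewrite ?scaler0.
move=> /componentP xi /componentP yi; apply/componentP.
by rewrite scalerDr scalerA mulrC -scalerA xi yi.
Qed.

Lemma component_zmod i : zmod_closed [in component N (e i)].
Proof. exact: GRing.submod_closedB (component_submod i). Qed.

Lemma component_direct_sum : is_direct_sum (fun i => component N (e i)).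
Proof.
split=> [i|x]; first exact: component_zmod.
exists [ffun i => e i *: x]; split=> [|y [yP ->]].
  split=> [i|]; first by rewrite ffunE; apply: component_scale.
  by rewrite {1}[x]sum_scale; apply: eq_bigr => i _; rewrite ffunE.
by apply/ffunP => i; rewrite ffunE scale_sum_component.
Qed.

End Modules.

Section Braces.
Variable N : rBraceType R.
Implicit Types (x y : N).

Lemma component_left_ideal i : is_left_ideal (component N (e i)).
Proof.
split=> [|x _ [a /componentP ai <-]]; first exact: component_zmod.
by apply/componentP; rewrite -gammaZ ai.
Qed.

Lemma component_left_R_ideal i : is_left_R_ideal (component N (e i)).
Proof. by split; [apply: component_left_ideal | apply: component_submod]. Qed.

Lemma component_normal_ideal :
  (forall i, is_circ_normal (component N (e i))) <->
  (forall i, is_ideal (component N (e i))).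
Proof.
split=> H i; last by case: (H i).
split=> //; first exact: component_left_ideal.
exact/add_normal_zmod_closed/component_zmod.
Qed.

Section Normal.
Hypothesis normal : forall i, is_circ_normal (component N (e i)).

(** Induction on the number of summands: if c is the first one, then
    c + d = c circle gamma_(c^-1)(d), and gamma_(c^-1)(d) has one summand less
    than c + d, in the same components because these are left ideals.  The
    summands u_j must be arbitrary for the induction hypothesis to apply to
    gamma_(c^-1)(d). *)
Lemma gamma_sum_fix i (s : seq 'I_t) (u : 'I_t -> N) (b : N) :
    (forall j, component N (e j) (u j)) -> component N (e i) b ->
  gamma (\sum_(j <- s | j != i) u j) b = b.
Proof.
move=> uP bi; elim: s u uP => [|k s IHs] u uP.
  by rewrite big_nil -brace_one gamma1.
rewrite big_cons; case: ifP => [ki|_]; last exact: IHs.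
set d := \sum_(j <- s | _) _.
have -> : u k + d = (u k * gamma (u k)^-1%g d)%g.
  by rewrite circ_gammaE -gammaM mulgV gamma1.
have -> : gamma (u k)^-1%g d = \sum_(j <- s | j != i) gamma (u k)^-1%g (u j).
  exact: (big_morph _ (gammaD N _) (gamma0 N _)).
rewrite gammaM IHs => [|j]; last first.
  exact: left_ideal_gamma (component_left_ideal j) (uP j).
apply: (normal_left_ideals_gamma_fix N (component_left_ideal k)
  (component_left_ideal i) (normal k) (normal i)) => //.
by move=> x; apply: componentI.
Qed.

Lemma gamma_complement_fix i x b :
  component N (e i) b -> gamma (x - e i *: x) b = b.
Proof.
have -> : x - e i *: x = \sum_(j < t | j != i) e j *: x.
  by rewrite {1}[x]sum_scale (bigD1 i) //= addrAC subrr add0r.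
by apply: gamma_sum_fix => j; apply: component_scale.
Qed.

Lemma gamma_component i x b :
  component N (e i) b -> gamma x b = gamma (e i *: x) b.
Proof.
move=> bi; set w := x - e i *: x; set a := e i *: x.
have wa : x = (w * a)%g.
  rewrite circ_gammaE gamma_complement_fix; last exact: component_scale.
  by rewrite subrK.
rewrite {1}wa gammaM gamma_complement_fix //.
exact: left_ideal_gamma (component_left_ideal i) bi.
Qed.

Lemma component_circM i x y : e i *: (x * y)%g = ((e i *: x) * (e i *: y))%g.
Proof.
rewrite !circ_gammaE scalerDr -gammaZ (gamma_component i x) //.
exact: component_scale.
Qed.

End Normal.

Lemma normal_decomposition :
  (forall i, is_circ_normal (component N (e i))) ->
  is_rBrace_decomposition N e.
Proof.
move=> normal; split.
- split=> [x _ i|x y _ _ /ffunP xy|y yP].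
  + by rewrite ffunE; apply: component_scale.
  + rewrite [x]sum_scale [y]sum_scale; apply: eq_bigr => i _.
    by have := xy i; rewrite !ffunE.
  + exists (\sum_(i < t) y i) => //.
    by apply/ffunP => i; rewrite ffunE scale_sum_component.
- by move=> x y; apply/ffunP => i; rewrite !ffunE scalerDr.
- by move=> x y; apply/ffunP => i; rewrite !ffunE component_circM.
- by move=> r x; apply/ffunP => i; rewrite !ffunE !scalerA mulrC.
Qed.

Lemma decomposition_normal :
  is_rBrace_decomposition N e ->
  forall i, is_circ_normal (component N (e i)).
Proof.
move=> [_ _ circM _] i; split.
  exact: left_ideal_group_closed (component_left_ideal i).
have eM j x y : e j *: (x * y)%g = ((e j *: x) * (e j *: y))%g.
  by have /ffunP /(_ j) := circM x y; rewrite !ffunE.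
move=> a x ai; apply/componentP; rewrite [RHS]sum_scale (bigD1 i) //=.
rewrite big1 ?addr0 // => j ji.
rewrite /conjg !eM (component_scale0 _ _ _ _ ji ai).
by rewrite -brace_one mul1g -eM mulVg brace_one scaler0.
Qed.

End Braces.
End Idempotents.

(** * The units of the summands of a ring *)

Section RingDirectSum.
Context {R : comPzRingType} {t : nat} {R_ : 'I_t -> set R} {e : 'I_t -> R}.
Hypothesis hR : is_ring_direct_sum R_ e.

Lemma rds_idem i : e i * e i = e i.
Proof. exact: (rds_mul1 hR (rds_one hR i)). Qed.

Lemma rds_orth i j : i != j -> e i * e j = 0.
Proof. by move=> ij; apply: (rds_mul0 hR ij); apply: rds_one hR _. Qed.

(** If 1 is the sum of y_i in R_i, then multiplying by e_i leaves e_i = y_i. *)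
Lemma rds_sum1 : \sum_(i < t) e i = 1.
Proof.
have [_ /(_ 1) [y [[yR y1] _]]] := rds_sum hR.
rewrite y1; apply: eq_bigr => i _.
rewrite -[LHS]mulr1 y1 mulr_sumr (bigD1 i) //= big1 ?addr0 => [|j ji].
  exact: (rds_mul1 hR (yR i)).
by apply: (rds_mul0 hR _ (rds_one hR i) (yR j)); rewrite eq_sym.
Qed.

Lemma rds_annihilates (N : lmodType R) i j r (x : N) :
  j != i -> R_ j r -> component N (e i) x -> r *: x = 0.
Proof.
move=> ji rj [z _ <-].
by rewrite scalerA (rds_mul0 hR ji rj (rds_one hR i)) scale0r.
Qed.

End RingDirectSum.

Theorem proposition3p6 (R : comPzRingType) (t : nat)
    (R_ : 'I_t -> set R) (e : 'I_t -> R) (hR : is_ring_direct_sum R_ e) :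
  (forall N : lmodType R,
    [/\ is_direct_sum (fun i => component N (e i)),
        forall i, submod_closed [in component N (e i)] &
        forall i j, j != i -> forall r x, R_ j r -> component N (e i) x ->
          r *: x = 0]) /\
  (forall N : rBraceType R,
    [/\ forall i, is_left_R_ideal (component N (e i)),
        (forall i, is_circ_normal (component N (e i))) <->
          (forall i, is_ideal (component N (e i))) &
        (forall i, is_circ_normal (component N (e i))) <->
          is_rBrace_decomposition N e]).
Proof.
have idem := rds_idem hR; have orth := rds_orth hR; have sum1 := rds_sum1 hR.
split=> N; split.
- exact: component_direct_sum.
- exact: component_submod.
- by move=> i j ji r x; apply: rds_annihilates.
- exact: component_left_R_ideal.
- exact: component_normal_ideal.
- by split; [apply: normal_decomposition | apply: decomposition_normal].
Qed.
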